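(* Let $a<b$ and $x_a,x_b>0$. Among kinetically admissible paths $\gamma$ on $[a,b]$ with $\gamma(a)=x_a$ and $\gamma(b)=x_b$, the unique minimizer of $\mathcal{A}$ is the path $$\gamma_*(t)=\exp\!\left(\log x_a+\frac{t-a}{b-a}\,(\log x_b-\log x_a)\right),$$ whose log-velocity $\frac{d}{dt}\log\gamma_*$ is the constant $(\log x_b-\log x_a)/(b-a)$. Its kinetic action is $$\mathcal{A}[\gamma_*]=(b-a)\left[\cosh\!\left(\frac{\log x_b-\log x_a}{b-a}\right)-1\right].$$
   Context: For $a<b$, an admissible path on $[a,b]$ is an absolutely continuous function $\gamma:[a,b]\to(0,\infty)$ (strictly positive at every point) with $\dot\gamma\in L^2([a,b])$. Its log-coordinate is $\xi:=\log\gamma$, which is absolutely continuous with $\dot\xi=\dot\gamma/\gamma\in L^2([a,b])$. An admissible path $\gamma$ is kinetically admissible if $\int_a^b[\cosh(\dot\xi(t))-1]\,dt<\infty$. For a kinetically admissible path the kinetic action is $\mathcal{A}[\gamma]:=\int_a^b[\cosh(\dot\xi(t))-1]\,dt$. *)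

(* Defs.v *)
From mathcomp Require Import all_boot all_order all_algebra.
From mathcomp Require Import all_classical all_reals all_analysis.

Set Implicit Arguments.
Unset Strict Implicit.
Unset Printing Implicit Defensive.

Import Order.TTheory GRing.Theory Num.Theory.
Import numFieldNormedType.Exports.

Local Open Scope classical_set_scope.
Local Open Scope ring_scope.

Definition cosh {R : realType} (x : R) : R := (expR x + expR (- x)) / 2.

Definition absolutely_continuous {R : realType} (a b : R) (f : R -> R) : Prop :=
  forall e : R, 0 < e -> exists2 d : R, 0 < d &
    forall (n : nat) (u v : 'I_n -> R),
      (forall i, a <= u i /\ u i <= v i /\ v i <= b) ->
      trivIset setT (fun i => `]u i, v i[%classic) ->
      \sum_(i < n) (v i - u i) < d ->
      \sum_(i < n) `|f (v i) - f (u i)| < e.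

(* Paths on [a, b] are total functions R -> R of which only the values on
   [a, b] matter.  derive1 g t is the usual derivative at every t in ]a, b[
   where g is differentiable, hence at almost every t in [a, b] when g is
   absolutely continuous there.  At the other points (including a and b, where
   it depends on g outside [a, b]) it is arbitrary, but these form a null set
   that the integrals below do not see. *)
Definition admissible {R : realType} (a b : R) (g : R -> R) : Prop :=
  [/\ absolutely_continuous a b g,
      (forall t, t \in `[a, b] -> 0 < g t) &
      (derive1 g \_ `[a, b]) \in Lfun (@lebesgue_measure R) 2%:E].

Definition log_coordinate {R : realType} (g : R -> R) : R -> R :=
  fun t => ln (g t).

Definition kinetic_action {R : realType} (a b : R) (g : R -> R) : \bar R :=
  (\int[@lebesgue_measure R]_(t in `[a, b])
     (cosh (derive1 (log_coordinate g) t) - 1)%:E)%E.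

Definition kinetically_admissible {R : realType} (a b : R) (g : R -> R) :
    Prop :=
  admissible a b g /\ (kinetic_action a b g < +oo)%E.

Definition kinetic_competitor {R : realType} (a b xa xb : R) (g : R -> R) :
    Prop :=
  [/\ kinetically_admissible a b g, g a = xa & g b = xb].

Definition kinetic_minimizer {R : realType} (a b xa xb : R) (g : R -> R) :
    Prop :=
  kinetic_competitor a b xa xb g /\
  forall h : R -> R, kinetic_competitor a b xa xb h ->
    (kinetic_action a b g <= kinetic_action a b h)%E.

Definition geometric_path {R : realType} (a b xa xb : R) : R -> R :=
  fun t => expR (ln xa + (t - a) / (b - a) * (ln xb - ln xa)).

(* Main.v *)
Require Import Defs.
From HB Require Import structures.
From mathcomp Require Import all_boot all_order all_algebra.
From mathcomp Require Import all_classical all_reals all_analysis.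
From mathcomp Require Import finmap measurable_realfun ring lra.

Import Order.TTheory GRing.Theory Num.Theory.
Import numFieldNormedType.Exports.

Local Open Scope classical_set_scope.
Local Open Scope ring_scope.

(** Write [xi = ln g] and [c = (ln xb - ln xa) / (b - a)].  The tangent
    inequality [cosh y >= cosh c + sinh c * (y - c)], strict for [y <> c],
    integrated against [y = xi'(t)], gives
    [A(g) >= (b - a) * (cosh c - 1)], because the linear term vanishes by
    [int xi' = xi b - xi a]; equality forces [xi' = c] almost everywhere, hence
    [xi] is affine.  The fundamental theorem of calculus for absolutely
    continuous functions comes from the Radon-Nikodym theorem: such a function
    is a difference of nondecreasing absolutely continuous ones (total
    variation), the Lebesgue-Stieltjes measure of a nondecreasing one is
    dominated by Lebesgue measure, and its density is the derivative almost
    everywhere by Lebesgue differentiation. *)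

(** * Absolute continuity along finite lists of intervals *)

(* Families of intervals are lists of endpoint pairs: unlike the families
   indexed by 'I_n of Defs.v, they can be refined by splicing in the pieces of
   a partition. *)
Definition disjoint_itv {R : realType} (I J : R * R) : bool :=
  (I.2 <= J.1) || (J.2 <= I.1).

Definition itv_family {R : realType} (a b : R) (s : seq (R * R)) : bool :=
  all (fun I => [&& a <= I.1, I.1 <= I.2 & I.2 <= b]) s && pairwise disjoint_itv s.

Definition family_length {R : realType} (s : seq (R * R)) : R :=
  \sum_(I <- s) (I.2 - I.1).

Definition family_variation {R : realType} (f : R -> R) (s : seq (R * R)) : R :=
  \sum_(I <- s) `|f I.2 - f I.1|.

Definition ac_on {R : realType} (a b : R) (f : R -> R) : Prop :=
  forall e : R, 0 < e -> exists2 d : R, 0 < d &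
    forall s, itv_family a b s -> family_length s < d -> family_variation f s < e.

Lemma absolutely_continuous_ac_on (R : realType) (a b : R) (f : R -> R) :
  absolutely_continuous a b f -> ac_on a b f.
Proof.
move=> acf e /acf[d d0 H]; exists d => // s /andP[/allP sab ds] sd.
rewrite /family_variation (big_nth (0, 0)) big_mkord.
apply: (H (size s) (fun i => (nth (0, 0) s i).1) (fun i => (nth (0, 0) s i).2)).
- by move=> i; have /and3P[] := sab _ (mem_nth (0, 0) (ltn_ord i)).
- have key : forall i j : 'I_(size s), (i < j)%N ->
      disjoint_itv (nth (0, 0) s i) (nth (0, 0) s j).
    by move=> i j ij; move/(pairwiseP (0, 0)): ds; apply => //; rewrite inE.
  apply/trivIsetP => /= i j _ _ ij; rewrite -subset0 => x /=.
  rewrite !in_itv/= => -[/andP[ix xi] /andP[jx xj]].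
  have : disjoint_itv (nth (0, 0) s i) (nth (0, 0) s j).
    have := ij; rewrite -val_eqE/= neq_ltn => /orP[|] ij'; first exact: key.
    by rewrite /disjoint_itv orbC; exact: key ij'.
  by move=> /orP[]; lra.
- by move: sd; rewrite /family_length (big_nth (0, 0)) big_mkord.
Qed.

Section pieces.
Context {R : realType}.
Implicit Types (u v : R) (l : seq R) (f : R -> R).

Lemma family_length_pairmap u l : family_length (pairmap pair u l) = last u l - u.
Proof.
rewrite /family_length; elim: l u => [|x l ih] u /=; first by rewrite big_nil subrr.
by rewrite big_cons ih /=; lra.
Qed.

Lemma family_variation_pairmap u v f l : itv_partition u v l ->
  family_variation f (pairmap pair u l) = variation u v f l.
Proof.
move=> ul; rewrite variation_zip//; rewrite /family_variation.
elim: l u {ul} => [|x l ih] u /=; first by rewrite !big_nil.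
by rewrite !big_cons ih.
Qed.

Lemma itv_family_pairmap u v l : itv_partition u v l ->
  itv_family u v (pairmap pair u l).
Proof.
elim: l u => [//|x l ih] u uxl.
have /andP[h1 h2] := ih _ (itv_partition_cons uxl).
have xv := itv_partition_le (itv_partition_cons uxl).
have ux : u < x by case: uxl => /= /andP[].
rewrite /itv_family/= lexx (ltW ux) xv h2 andbT /=; apply/andP; split.
  refine (sub_all _ h1) => I /and3P[xI -> ->]; rewrite !andbT.
  exact: le_trans (ltW ux) xI.
by rewrite andbT; refine (sub_all _ h1) => I /and3P[xI _ _]; rewrite /disjoint_itv/= xI.
Qed.

Lemma disjoint_itvC : symmetric (@disjoint_itv R).
Proof. by move=> I J; rewrite /disjoint_itv orbC. Qed.

Lemma disjoint_itvS (I J K : R * R) : I.1 <= J.1 -> J.2 <= I.2 ->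
  disjoint_itv I K -> disjoint_itv J K.
Proof. by rewrite /disjoint_itv => h1 h2 /orP[]; lra. Qed.

Lemma itv_family_refine (a b : R) u v s t l : itv_partition u v l ->
  itv_family a b (((u, v) :: s) ++ t) ->
  itv_family a b (s ++ (pairmap pair u l ++ t)).
Proof.
move=> /itv_family_pairmap /andP[al pl].
rewrite /itv_family/= all_cat pairwise_cat => /andP[/and3P[/and3P[au uv vb] sa ta]].
move=> /and4P[duv st ps pt].
have dl K : disjoint_itv (u, v) K -> all (disjoint_itv^~ K) (pairmap pair u l).
  move=> h; refine (sub_all _ al) => I /and3P[uI _ Iv].
  exact: disjoint_itvS h.
move: duv; rewrite all_cat => /andP[ds dt].
rewrite !all_cat !pairwise_cat allrel_catr sa ta ps pt pl st /= !andbT.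
apply/and3P; split.
- refine (sub_all _ al) => I /and3P[? -> ?]; rewrite (le_trans au)//=.
  exact: le_trans vb.
- rewrite allrelC (eq_allrel (r' := disjoint_itv)); last by move=> I J; rewrite disjoint_itvC.
  apply/allrelP => I J Il Js; move/allP: ds => /(_ _ Js) /dl /allP; exact.
- apply/allrelP => I J Il Js; move/allP: dt => /(_ _ Js) /dl /allP; exact.
Qed.

Lemma itv_family_behead (a b : R) I s t :
  itv_family a b ((I :: s) ++ t) -> itv_family a b (s ++ t).
Proof. by rewrite /itv_family/= => /andP[/andP[_ ->] /andP[_ ->]]. Qed.

(* The intervals of [s] are processed one at a time; [t] collects the pieces of
   those already replaced by a partition. *)
Lemma total_variation_family_le (a b : R) f (d e : R) :
  (forall s, itv_family a b s -> family_length s < d -> family_variation f s < e) ->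
  forall s t, itv_family a b (s ++ t) -> family_length (s ++ t) < d ->
  (\sum_(I <- s) total_variation I.1 I.2 f + (family_variation f t)%:E <= e%:E)%E.
Proof.
move=> H; elim => [|[u v] s ih] t st std.
  by rewrite big_nil add0e lee_fin ltW// H.
have uv : u <= v by case/andP: st => /= /andP[/and3P[]].
rewrite big_cons/= -addeA.
set X := (X in (_ + X)%E).
have len0 : family_length (s ++ t) <= family_length (((u, v) :: s) ++ t).
  by rewrite /family_length /= big_cons/= lerDr; lra.
have Xe : (X <= e%:E)%E by apply: ih; [exact: itv_family_behead st | exact: le_lt_trans std].
have X0 : (0 <= X)%E.
  rewrite adde_ge0// ?lee_fin; last by apply: sumr_ge0.
  rewrite big_seq sume_ge0// => I Is; apply: total_variation_ge0.
  by case/andP: st; rewrite /= => /andP[_]; rewrite all_cat => /andP[/allP/(_ _ Is)/and3P[]].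
have Xf : X \is a fin_num by rewrite fin_real// (lt_le_trans _ X0)//= (le_lt_trans Xe) ?ltry.
rewrite -leeBrDr//; apply: ge_ereal_sup => _ [_ [l ul <-] <-].
rewrite leeBrDr// addeC /X -addeA -EFinD [family_variation f t + _]addrC.
have -> : variation u v f l + family_variation f t =
    family_variation f (pairmap pair u l ++ t).
  by rewrite -(@family_variation_pairmap u v)// /family_variation big_cat.
apply: ih; first exact: itv_family_refine st.
apply: le_lt_trans std; rewrite /family_length !big_cat/= big_cons/=.
have := family_length_pairmap u l; rewrite /family_length => ->.
by case: ul => _ /eqP ->; lra.
Qed.

End pieces.

Section ac_variation.
Context {R : realType}.
Implicit Types (a b : R) (f : R -> R).

Lemma ac_on_total_variation a b f (e : R) : 0 < e -> ac_on a b f ->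
  exists2 d, 0 < d & forall s, itv_family a b s -> family_length s < d ->
    (\sum_(I <- s) total_variation I.1 I.2 f <= e%:E)%E.
Proof.
move=> e0 /(_ _ e0)[d d0 H]; exists d => // s sab sd.
have := @total_variation_family_le R a b f d e H s [::].
by rewrite cats0 /family_variation big_nil adde0; exact.
Qed.

Lemma ac_on_bounded_variation a b f : a <= b -> ac_on a b f ->
  bounded_variation a b f.
Proof.
move=> ab /(ac_on_total_variation _ _ _ _ ltr01)[d d0 H].
have step (u v : R) : a <= u -> u <= v -> v <= b -> v - u < d ->
    total_variation u v f \is a fin_num.
  move=> au uv vb vud.
  have := H [:: (u, v)]; rewrite /itv_family/= au uv vb => /(_ isT).
  rewrite /family_length !big_seq1 => /(_ vud) h.
  by rewrite ge0_fin_numE ?total_variation_ge0// (le_lt_trans h) ?ltry.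
have main n x : a <= x -> x <= b -> x - a < n%:R * (d / 2) ->
    total_variation a x f \is a fin_num.
  elim: n x => [|n ih] x ax xb; first by rewrite mul0r; lra.
  rewrite -natr1 mulrDl mul1r => xan.
  have [xd|xd] := ltP (x - a) d; first by rewrite step.
  rewrite (@total_variationD _ _ _ (x - d / 2)); [|lra|lra].
  by rewrite fin_numD ih ?step//; lra.
apply/(bounded_variationP _ ab).
apply: (main (Num.bound ((b - a) / (d / 2)))) => //.
rewrite -ltr_pdivrMr; last lra.
by apply: archimedean.Num.Theory.archi_boundP; rewrite divr_ge0//; lra.
Qed.

End ac_variation.

Section ac_decomposition.
Context {R : realType}.
Implicit Types (a b : R) (f g : R -> R).

Lemma ac_onB a b f g : ac_on a b f -> ac_on a b g -> ac_on a b (f \- g).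
Proof.
move=> hf hg e e0; have e20 : 0 < e / 2 by lra.
have [d d0 H] := hf _ e20; have [d' d'0 H'] := hg _ e20.
exists (Num.min d d'); first by rewrite lt_min d0.
move=> s sab; rewrite lt_min => /andP[sd sd'].
rewrite (splitr e); apply: le_lt_trans (ltrD (H _ sab sd) (H' _ sab sd')).
rewrite /family_variation -big_split/=; apply: ler_sum => I _.
have -> : (f \- g) I.2 - (f \- g) I.1 = (f I.2 - f I.1) - (g I.2 - g I.1).
  by rewrite /=; ring.
exact: ler_normB.
Qed.

Lemma fine_total_variationB a b x y f : bounded_variation a b f ->
  a <= x -> x <= y -> y <= b ->
  (fine (total_variation a y f) - fine (total_variation a x f))%:E =
  total_variation x y f.
Proof.
move=> bvf ax xy yb.
have ay := le_trans ax xy; have xb := le_trans xy yb.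
have h1 : total_variation a x f \is a fin_num.
  by apply/bounded_variationP => //; exact: bounded_variationl bvf.
have h2 : total_variation x y f \is a fin_num.
  apply/bounded_variationP => //; apply: (@bounded_variationl _ _ _ b) => //.
  exact: (@bounded_variationr _ a).
by rewrite (total_variationD f ax xy) fineD// addrAC subrr add0r fineK.
Qed.

Lemma ac_on_fine_total_variation a b f : a <= b -> ac_on a b f ->
  ac_on a b (fun x => fine (total_variation a x f)).
Proof.
move=> ab acf e e0; have e20 : 0 < e / 2 by lra.
have bvf := ac_on_bounded_variation _ _ _ ab acf.
have [d d0 H] := ac_on_total_variation _ _ _ _ e20 acf.
exists d => // s sab sd; apply: (@le_lt_trans _ _ (e / 2)); last lra.
rewrite -lee_fin; apply: le_trans (H _ sab sd).
rewrite /family_variation -sumEFin big_seq [leRHS]big_seq; apply: lee_sum => I Is.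
have /andP[/allP/(_ _ Is)/and3P[aI I12 Ib] _] := sab.
have := fine_total_variationB _ _ _ _ _ bvf aI I12 Ib => <-.
rewrite lee_fin ger0_norm// -lee_fin (fine_total_variationB _ b)//.
exact: total_variation_ge0.
Qed.

Lemma ac_on_nondecreasing_decomposition a b f : a <= b -> ac_on a b f ->
  exists p q, [/\ f = p \- q, ac_on a b p, ac_on a b q,
    {in `[a, b] &, nondecreasing_fun p} & {in `[a, b] &, nondecreasing_fun q}].
Proof.
move=> ab acf; have bvf := ac_on_bounded_variation _ _ _ ab acf.
pose p x := fine (total_variation a x f).
have acp : ac_on a b p by exact: ac_on_fine_total_variation.
have key x y : a <= x -> x <= y -> y <= b -> `|f y - f x| <= p y - p x.
  move=> ax xy yb; rewrite -lee_fin (fine_total_variationB _ b)//.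
  exact: total_variation_ge.
exists p, (p \- f); split => //.
- by apply/funext => x /=; rewrite opprB addrC subrK.
- exact: ac_onB.
- move=> x y; rewrite !in_itv/= => /andP[ax xb] /andP[ay yb] xy.
  by rewrite -subr_ge0 (le_trans _ (key _ _ ax xy yb)).
- move=> x y; rewrite !in_itv/= => /andP[ax xb] /andP[ay yb] xy.
  by have := le_trans (ler_norm _) (key _ _ ax xy yb); rewrite /=; lra.
Qed.

End ac_decomposition.

(** * The Lebesgue-Stieltjes measure of an absolutely continuous function *)

Section clamp.
Context {R : realType} (a b : R).
Hypothesis ab : a <= b.

Definition clamp (x : R) : R := Num.max a (Num.min x b).

Lemma clamp_ge x : a <= clamp x. Proof. by rewrite /clamp le_max lexx. Qed.

Lemma clamp_le x : clamp x <= b.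
Proof. by rewrite /clamp ge_max ab ge_min lexx orbT. Qed.

Lemma clamp_id x : a <= x -> x <= b -> clamp x = x.
Proof. by move=> ax xb; rewrite /clamp min_l// max_r. Qed.

Lemma clamp_homo x y : x <= y -> clamp x <= clamp y.
Proof.
move=> xy; rewrite /clamp ge_max le_max lexx/= le_max.
have -> : Num.min x b <= Num.min y b by rewrite le_min !ge_min xy lexx orbT.
by rewrite orbT.
Qed.

Lemma clamp_lipschitz x y : x <= y -> clamp y - clamp x <= y - x.
Proof.
move=> xy; rewrite /clamp; case: (leP x b) => xb; case: (leP y b) => yb.
- by case: (leP a x) => ?; case: (leP a y) => ?; lra.
- by case: (leP a x) => ?; case: (leP a b) => ?; lra.
- by case: (leP a y) => ?; case: (leP a b) => ?; lra.
- by rewrite subrr subr_ge0.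
Qed.

Definition clamp_itv (I : R * R) : R * R := (clamp I.1, clamp I.2).

Lemma itv_family_clamp (s : seq (R * R)) :
  all (fun I => I.1 <= I.2) s -> pairwise disjoint_itv s ->
  itv_family a b (map clamp_itv s).
Proof.
move=> s12 ds; apply/andP; split.
  rewrite all_map; refine (sub_all _ s12) => I /= I12.
  by rewrite clamp_ge clamp_le clamp_homo.
rewrite pairwise_map; apply: sub_pairwise ds => I J.
by rewrite /disjoint_itv/= => /orP[] h; rewrite (clamp_homo _ _ h) ?orbT.
Qed.

Lemma family_length_clamp (s : seq (R * R)) : all (fun I => I.1 <= I.2) s ->
  family_length (map clamp_itv s) <= family_length s.
Proof.
move=> /allP s12; rewrite /family_length big_map big_seq [leRHS]big_seq.
by apply: ler_sum => I /s12; exact: clamp_lipschitz.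
Qed.

End clamp.

Section clamped_cumulative.
Context {R : realType} (a b : R) (g : R -> R).
Hypotheses (ab : a <= b) (ndg : {in `[a, b] &, nondecreasing_fun g})
  (acg : ac_on a b g).

Definition clamped (x : R) : R := g (clamp a b x).

Lemma clamped_nondecreasing : nondecreasing clamped.
Proof.
by move=> x y xy; apply: ndg; rewrite ?in_itv/= ?clamp_ge ?clamp_le// clamp_homo.
Qed.

Lemma clamped_continuous : continuous clamped.
Proof.
move=> x; apply/cvgrPdist_lt => e /acg[d d0 H].
have main u v : u <= v -> v - u < d -> `|clamped v - clamped u| < e.
  move=> uv uvd.
  have := H (map (clamp_itv a b) [:: (u, v)]).
  rewrite /family_variation big_map big_seq1; apply.
    by apply: itv_family_clamp => //=; rewrite uv.
  apply: (@le_lt_trans _ _ (family_length [:: (u, v)])).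
    by apply: family_length_clamp => //=; rewrite uv.
  by rewrite /family_length big_seq1.
near=> y; have xyd : `|x - y| < d by near: y; apply: cvgr_dist_lt => //; exact: cvg_id.
have [xy|/ltW yx] := leP x y.
  by rewrite distrC main// -(ger0_norm (_ : 0 <= y - x)) ?subr_ge0// distrC.
by rewrite main// -(ger0_norm (_ : 0 <= x - y)) ?subr_ge0.
Unshelve. all: by end_near. Qed.

Lemma clamped_right_continuous : right_continuous clamped.
Proof. exact/right_continuousW/clamped_continuous. Qed.

End clamped_cumulative.

Lemma ocitv_disjoint (R : realType) (I J : R * R) : I.1 < I.2 -> J.1 < J.2 ->
  `]I.1, I.2]%classic `&` `]J.1, J.2]%classic = set0 -> disjoint_itv I J.
Proof.
move=> I12 J12 IJ; rewrite /disjoint_itv; apply/negP => /negP.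
rewrite negb_or -!ltNge => /andP[JI IJ2].
have : set0 (Num.min I.2 J.2).
  rewrite -IJ; split => /=; rewrite in_itv/= lt_min ge_min lexx ?orbT andbT.
    by rewrite I12 IJ2.
  by rewrite J12 JI.
by [].
Qed.

Lemma ocitv_ring_family (R : realType) (A : set (SetRing.type (ocitv_type R))) :
  measurable A ->
  exists s : seq (R * R), [/\ all (fun I => I.1 <= I.2) s, pairwise disjoint_itv s &
    forall m : {measure set (measurableTypeR R) -> \bar R},
      m A = (\sum_(I <- s) m `]I.1, I.2]%classic)%E].
Proof.
move=> /SetRing.ring_finite_set[B [/finite_fsetP[X ->] B0 tB mB ->]].
have /choice[h hP] : forall Y : set R, exists I : R * R, Y \in X ->
    I.1 < I.2 /\ Y = `]I.1, I.2]%classic.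
  move=> Y; have [YX|] := boolP (Y \in X); last by exists (0, 0).
  have /ocitvP[Y0|[I I12 YE]] : ocitv Y by apply: mB; exact: mem_set.
    by have [] := B0 _ YX; rewrite Y0.
  by exists I.
exists (map h X); split.
- by rewrite all_map; apply/allP => Y /hP[/ltW].
- rewrite pairwise_map; apply/(pairwiseP set0) => i j iX jX ij.
  have [hi Ei] := hP _ (mem_nth set0 iX); have [hj Ej] := hP _ (mem_nth set0 jX).
  apply: ocitv_disjoint => //; rewrite -Ei -Ej.
  apply/eqP/negPn/negP => /set0P IJ.
  have := tB _ _ (mem_nth set0 iX) (mem_nth set0 jX) IJ.
  by move=> /eqP; rewrite nth_uniq ?fset_uniq// (ltn_eqF ij).
- move=> m; rewrite big_map big_seq.
  under [RHS]eq_bigr => Y YX do rewrite -(hP _ YX).2.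
  rewrite -big_seq -measure_fbigsetU.
  - by rewrite -bigcup_fset; congr (m _); apply: eq_bigcupl; split => Y /=; rewrite inE.
  - by move=> Y YX; apply: sub_sigma_algebra; apply: mB; exact: mem_set.
  - exact: tB.
Qed.

Definition ac_increments (R : realType) (G : R -> R) : Prop :=
  forall e : R, 0 < e -> exists2 d : R, 0 < d & forall s : seq (R * R),
    all (fun I => I.1 <= I.2) s -> pairwise disjoint_itv s ->
    family_length s < d -> \sum_(I <- s) (G I.2 - G I.1) <= e.

Section stieltjes_dominated.
Context {R : realType} (G : cumulative R R).

Local Notation nu := (lebesgue_stieltjes_measure G).
Local Notation mu := (@lebesgue_measure R).

Lemma lebesgue_stieltjes_itv u v : u <= v -> nu `]u, v] = (G v - G u)%:E.
Proof.
move=> uv; rewrite /lebesgue_stieltjes_measure /measure_extension.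
rewrite measurable_mu_extE; last exact: is_ocitv.
exact: wlength_itv_bnd.
Qed.

Lemma ac_increments_ring e d :
  (forall s : seq (R * R),
    all (fun I => I.1 <= I.2) s -> pairwise disjoint_itv s ->
    family_length s < d -> \sum_(I <- s) (G I.2 - G I.1) <= e) ->
  forall A : set (SetRing.type (ocitv_type R)), measurable A ->
    (mu A < d%:E)%E -> (nu A <= e%:E)%E.
Proof.
move=> H A /ocitv_ring_family[s [s12 ds ms]].
have sE (m : {measure set (measurableTypeR R) -> \bar R}) (F : R -> R) :
    (forall u v, u <= v -> m `]u, v]%classic = (F v - F u)%:E) ->
    m A = (\sum_(I <- s) (F I.2 - F I.1))%:E.
  move=> mF; rewrite ms -sumEFin big_seq [RHS]big_seq; apply: eq_bigr => I Is.
  by rewrite mF//; exact: (allP s12).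
rewrite (sE mu id) => [|u v uv]; last first.
  rewrite [LHS](lebesgue_measure_itv `]u, v])/= lte_fin.
  by case: ltgtP uv => // -> _; rewrite subrr.
rewrite (sE nu G) ?lee_fin ?lte_fin; first exact: H.
exact: lebesgue_stieltjes_itv.
Qed.

Lemma stieltjes_dominated : ac_increments R G -> nu `<< mu.
Proof.
move=> acG; apply/null_content_dominatesP => E mE muE0.
apply/eqP; rewrite eq_le measure_ge0 andbT; apply/lee_addgt0Pr => e e0.
rewrite add0e; have [d d0 H] := acG _ e0.
have d20 : 0 < d / 2 by lra.
have : (mu E < (d / 2)%:E)%E by rewrite [X in (X < _)%E]muE0 lte_fin.
have -> : mu E = mu_ext (wlength (@idfun R)) E by reflexivity.
move=> /ereal_inf_lt[_ [A [mA EA] <-] Ad].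
pose U n := \bigcup_(k < n) A k.
have rA k : @measurable _ (SetRing.type (ocitv_type R)) (A k).
  by apply: SetRing.measurable_subring; exact: mA.
have mAk k : @measurable _ (measurableTypeR R) (A k).
  by apply: sub_sigma_algebra; exact: mA.
have rU n : @measurable _ (SetRing.type (ocitv_type R)) (U n).
  by apply: fin_bigcup_measurable => //; exact: finite_II.
have mU n : @measurable _ (measurableTypeR R) (U n).
  by apply: bigcup_measurable.
have muU n : (mu (U n) < d%:E)%E.
  apply: (@le_lt_trans _ _ (\sum_(k <oo) mu (A k))%E).
    apply: measure_sigma_subadditive => //.
    by move=> x [k _ Akx]; exists k.
  rewrite (_ : (\sum_(k <oo) mu (A k))%E = (\sum_(k <oo) wlength idfun (A k))%E).
    by apply: lt_trans Ad _; rewrite lte_fin; lra.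
  by apply: eq_eseriesr => k _; exact: (measurable_mu_extE (wlength idfun) (mA k)).
have nuU n : (nu (U n) <= e%:E)%E.
  by apply: (@ac_increments_ring e d).
apply: (@le_trans _ _ (nu (\bigcup_n U n))).
  apply: le_measure; [exact: mem_set | by apply/mem_set/bigcup_measurable => k _; exact: mU |].
  by move=> x /EA[k _ Akx]; exists k.+1 => //; exists k => //=.
have cv : nu (U n) @[n --> \oo] --> nu (\bigcup_n U n).
  apply: nondecreasing_cvg_mu; [exact: mU | by apply: bigcup_measurable => k _; exact: mU |].
  by move=> m n mn; apply/subsetPset => x [k /= km Ax]; exists k => //=; exact: leq_trans mn.
rewrite -(cvg_lim _ cv)//; apply: lime_le; last exact: nearW.
by apply/cvg_ex; exists (nu (\bigcup_n U n)).
Qed.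

End stieltjes_dominated.

Section nondecreasing_ac.
Context {R : realType} (a b : R) (g : R -> R).
Hypotheses (ab : a <= b) (ndg : {in `[a, b] &, nondecreasing_fun g})
  (acg : ac_on a b g).
Local Notation mu := (@lebesgue_measure R).

Lemma clamped_ac_increments : ac_increments R (clamped a b g).
Proof.
move=> e /acg[d d0 H]; exists d => // s s12 ds sd.
have := H (map (clamp_itv a b) s) (itv_family_clamp _ _ ab _ s12 ds).
move=> /(_ (le_lt_trans (family_length_clamp _ _ _ s12) sd)) /ltW.
apply: le_trans; rewrite /family_variation big_map.
by apply: ler_sum => I _; exact: ler_norm.
Qed.

Lemma nondecreasing_ac_on_integral : exists phi : R -> R,
  mu.-integrable setT (EFin \o phi) /\
  forall x, a <= x -> x <= b -> g x - g a = (\int[mu]_(t in `[a, x]) phi t).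
Proof.
pose cG := isCumulative.Build _ _ _ (clamped a b g)
  (clamped_nondecreasing _ _ _ ab ndg) (clamped_right_continuous _ _ _ ab acg).
pose G : cumulative R R := HB.pack (clamped a b g) cG.
have dom := stieltjes_dominated G clamped_ac_increments.
pose nu : {measure set (measurableTypeR R) -> \bar R} := lebesgue_stieltjes_measure G.
have mD : @measurable _ (measurableTypeR R) `]a, b]%classic by [].
have nuD : (nu `]a, b]%classic < +oo)%E.
  by rewrite [X in (X < _)%E](lebesgue_stieltjes_itv G _ _ ab) ltry.
have domD : mfrestr mD nuD `<< mu.
  apply/null_content_dominatesP => E mE muE.
  move/null_content_dominatesP : dom => /(_ _ mE muE) nuE.
  apply/eqP; rewrite -measure_le0 -[leRHS]nuE.
  rewrite /mfrestr /mrestr; apply: le_measure => //; apply: mem_set => //.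
  exact: measurableI.
have [phi [phi0 phifin iphi phiE]] := radon_nikodym_sigma_finite domD.
have phiEE : EFin \o (fine \o phi) = phi by apply/funext => x /=; rewrite fineK.
exists (fine \o phi); split; first by rewrite phiEE.
move=> x ax xb; rewrite /Rintegral.
under eq_integral do rewrite /= fineK//.
rewrite -[LHS]/(fine (g x - g a)%:E); congr fine.
transitivity (nu `]a, x]%classic).
  by rewrite [RHS](lebesgue_stieltjes_itv G _ _ ax)/= /clamped !clamp_id.
transitivity (mfrestr mD nuD `]a, x]%classic).
  by rewrite /mfrestr /mrestr setIidl//; apply: subset_itvl; rewrite bnd_simp.
rewrite phiE// integral_itv_obnd_cbnd//.
by refine (measurable_funS _ _ (measurable_int mu iphi)); [exact: measurableT | exact: subsetT].
Qed.

End nondecreasing_ac.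

Section ac_integral.
Context {R : realType} (a b : R) (f : R -> R).
Hypotheses (ab : a <= b) (acf : ac_on a b f).
Local Notation mu := (@lebesgue_measure R).

Lemma ac_on_integral : exists phi : R -> R,
  mu.-integrable setT (EFin \o phi) /\
  forall x, a <= x -> x <= b -> f x - f a = (\int[mu]_(t in `[a, x]) phi t).
Proof.
have [p [q [-> acp acq ndp ndq]]] := ac_on_nondecreasing_decomposition _ _ _ ab acf.
have [phi [iphi phiE]] := nondecreasing_ac_on_integral _ _ _ ab ndp acp.
have [psi [ipsi psiE]] := nondecreasing_ac_on_integral _ _ _ ab ndq acq.
exists (phi \- psi); split.
  rewrite (_ : _ \o _ = (EFin \o phi) \- (EFin \o psi))%E; last exact/funext.
  exact: integrableB.
move=> x ax xb; rewrite RintegralB//; [|exact: integrableS iphi|exact: integrableS ipsi].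
by rewrite -phiE// -psiE//=; ring.
Qed.

End ac_integral.

Section ac_derive.
Context {R : realType} (a b : R) (f phi : R -> R).
Local Notation mu := (@lebesgue_measure R).
Hypothesis iphi : mu.-integrable setT (EFin \o phi).
Hypothesis phiE : forall x, a <= x -> x <= b ->
  f x - f a = (\int[mu]_(t in `[a, x]) phi t).

Lemma integral_ae_derive :
  {ae mu, forall x, x \in `]a, b[ -> is_derive x 1 f (phi x)}.
Proof.
have loc : locally_integrable setT phi.
  by apply: open_integrable_locally => //; exact: openT.
have int y : mu.-integrable [set` Interval (BLeft a) (BRight y)] (EFin \o phi).
  by apply: integrableS iphi.
have := FTC1 int loc; apply: filterS; first exact: (ae_filter_ringOfSetsType mu).
move=> x H; rewrite in_itv/= => /andP[ax xb].
have [|dF F'] := H; first by rewrite lte_fin.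
have : is_derive x 1 (fun x => f a + \int[mu]_(t in `[a, x]) phi t) (phi x).
  rewrite -[phi x]add0r.
  apply: is_deriveD; rewrite -F' derive1E; exact: DeriveDef.
apply: near_eq_is_derive.
near=> y; have ay : a < y by near: y; exact: lt_nbhsr.
have yb : y < b by near: y; exact: lt_nbhsl.
by rewrite -phiE ?ltW// addrC subrK.
Unshelve. all: by end_near. Qed.

End ac_derive.

Lemma ac_on_ln (R : realType) (a b : R) (g : R -> R) : a <= b ->
  ac_on a b g -> (forall t, t \in `[a, b] -> 0 < g t) -> ac_on a b (fun t => ln (g t)).
Proof.
move=> ab acg g0.
have gc : {within `[a, b], continuous (clamped a b g)}.
  by apply: continuous_subspaceT; exact: clamped_continuous ab acg.
have [c cab cmin] := EVT_min ab gc.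
pose m := clamped a b g c.
have m0 : 0 < m by apply: g0; rewrite in_itv/= clamp_ge clamp_le.
have gm t : a <= t -> t <= b -> m <= g t.
  by move=> at_ tb; have := cmin t; rewrite in_itv/= at_ tb /clamped (clamp_id _ _ t)//; exact.
have key u v : a <= u -> u <= b -> a <= v -> v <= b ->
    ln (g v) - ln (g u) <= `|g v - g u| / m.
  move=> au ub av vb; have gu := gm _ au ub; have gv := gm _ av vb.
  have gu0 : 0 < g u by exact: lt_le_trans gu.
  have gv0 : 0 < g v by exact: lt_le_trans gv.
  rewrite -ln_div ?posrE//; apply: (@le_trans _ _ ((g v - g u) / g u)).
    have -> : g v / g u = 1 + (g v - g u) / g u by field; rewrite gt_eqF.
    apply: le_ln1Dx; rewrite ltr_pdivlMr//; lra.
  apply: (@le_trans _ _ (`|g v - g u| / g u)).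
    by rewrite ler_pM2r ?invr_gt0// ler_norm.
  by rewrite ler_wpM2l// lef_pV2 ?posrE.
move=> e e0; have [d d0 H] := acg _ (mulr_gt0 e0 m0).
exists d => // s sab sd; have /andP[/allP sP _] := sab.
have := H s sab sd; rewrite -ltr_pdivrMr//; apply: le_lt_trans.
rewrite /family_variation mulr_suml big_seq [leRHS]big_seq; apply: ler_sum => I Is.
have /and3P[aI I12 Ib] := sP _ Is.
have Ib1 := le_trans I12 Ib; have aI2 := le_trans aI I12.
have h1 := key I.1 I.2 aI Ib1 aI2 Ib.
have h2 := key I.2 I.1 aI2 Ib aI Ib1; rewrite distrC in h2.
by rewrite ler_norml; apply/andP; split; lra.
Qed.

(** * Kinetic action *)

Section cosh_convexity.
Context {R : realType}.
Implicit Types c y : R.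

Definition cosh_slope c : R := (expR c - expR (- c)) / 2.

Definition cosh_excess c y : R := cosh y - cosh c - cosh_slope c * (y - c).

Lemma cosh_excessE c y : cosh_excess c y =
  (expR c * (expR (y - c) - (1 + (y - c))) +
   expR (- c) * (expR (- (y - c)) - (1 + - (y - c)))) / 2.
Proof.
rewrite /cosh_excess /cosh_slope /cosh !mulrBr -!expRD.
have -> : c + (y - c) = y by ring.
have -> : - c + - (y - c) = - y by ring.
by field.
Qed.

Lemma cosh_excess_ge0 c y : 0 <= cosh_excess c y.
Proof.
rewrite cosh_excessE divr_ge0// addr_ge0// mulr_ge0 ?expR_ge0// subr_ge0.
  exact: expR_ge1Dx.
exact: expR_ge1Dx.
Qed.

Lemma cosh_excess_eq0 c y : cosh_excess c y = 0 -> y = c.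
Proof.
move=> e0; apply/eqP; apply: contraPT e0 => yc; apply/eqP; rewrite gt_eqF//.
rewrite cosh_excessE divr_gt0// ltr_pwDl//.
  by rewrite mulr_gt0 ?expR_gt0// subr_gt0 expR_gt1Dx// subr_eq0.
by rewrite mulr_ge0 ?expR_ge0// subr_ge0 expR_ge1Dx.
Qed.

Lemma cosh_ge1 y : 1 <= cosh y.
Proof.
have := cosh_excess_ge0 0 y.
by rewrite /cosh_excess /cosh_slope /cosh !oppr0 expR0 subrr; lra.
Qed.

End cosh_convexity.

Section geometric_path.
Context {R : realType} (a b xa xb : R).
Hypothesis ab : a < b.
Hypotheses (xa0 : 0 < xa) (xb0 : 0 < xb).
Local Notation gamma := (geometric_path a b xa xb).
Local Notation c := ((ln xb - ln xa) / (b - a)).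
Local Notation mu := (@lebesgue_measure R).

Lemma geometric_path_gt0 t : 0 < gamma t.
Proof. exact: expR_gt0. Qed.

Lemma geometric_path_left : gamma a = xa.
Proof. by rewrite /geometric_path subrr !mul0r addr0 lnK. Qed.

Lemma geometric_path_right : gamma b = xb.
Proof.
rewrite /geometric_path divff ?mul1r; last by rewrite subr_eq0 gt_eqF.
by rewrite addrC subrK lnK.
Qed.

Lemma log_geometric_path t : log_coordinate gamma t = ln xa + (t - a) * c.
Proof. by rewrite /log_coordinate /geometric_path expRK; congr (_ + _); ring. Qed.

Lemma is_derive_log_geometric_path (t : R) : is_derive t 1 (log_coordinate gamma) c.
Proof.
rewrite (_ : log_coordinate _ = (fun t => ln xa + (t - a) * c)); last first.
  by apply/funext => x; rewrite log_geometric_path.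
by apply: is_derive_eq; rewrite /GRing.scale/=; ring.
Qed.

Lemma is_derive_geometric_path (t : R) : is_derive t 1 gamma (gamma t * c).
Proof.
have -> : gamma = expR \o log_coordinate gamma.
  by apply/funext => x /=; rewrite lnK// posrE geometric_path_gt0.
rewrite [X in X * _]/=.
have := is_derive_log_geometric_path t => h.
apply: is_derive1_comp.
Qed.

Lemma geometric_path_bound t : a <= t -> t <= b -> gamma t <= expR (`|ln xa| + `|ln xb|).
Proof.
move=> at_ tb; rewrite ler_expR.
have th0 : 0 <= (t - a) / (b - a) by apply: divr_ge0; lra.
have th1 : (t - a) / (b - a) <= 1 by rewrite ler_pdivrMr ?mul1r ?subr_gt0 ?lerD2r.
set th := _ / _ in th0 th1 *.
have h1 := ler_norm (ln xa); have h2 := ler_norm (ln xb).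
have n1 := normr_ge0 (ln xa); have n2 := normr_ge0 (ln xb).
by nra.
Qed.

Lemma geometric_path_ac : absolutely_continuous a b gamma.
Proof.
set K := expR (`|ln xa| + `|ln xb|) * `|c| + 1.
have K0 : 0 < K by rewrite ltr_wpDl// mulr_ge0 ?expR_ge0.
have key u v : a <= u -> u <= b -> a <= v -> v <= b ->
    gamma v - gamma u <= `|v - u| * K.
  move=> au ub av vb.
  have E : gamma u = gamma v * expR (- ((v - u) * c)).
    by rewrite /geometric_path -expRD; congr expR; ring.
  have h1 := expR_ge1Dx (- ((v - u) * c)).
  have g0 := geometric_path_gt0 v.
  have h2 : gamma v - gamma u <= gamma v * ((v - u) * c) by rewrite E; nra.
  apply: (le_trans h2); apply: (@le_trans _ _ (gamma v * (`|v - u| * `|c|))).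
    by rewrite ler_pM2l// -normrM ler_norm.
  rewrite mulrCA ler_wpM2l// /K.
  have := geometric_path_bound v av vb; have := normr_ge0 c.
  move: (expR _) `|c| => A B; nra.
move=> e e0; exists (e / K); first by rewrite divr_gt0.
move=> n u v uv _ sd; apply: (@le_lt_trans _ _ (\sum_(i < n) (v i - u i) * K)).
  apply: ler_sum => i _; have [aui [uvi vib]] := uv i.
  have ub := le_trans uvi vib; have av := le_trans aui uvi.
  have h1 := key _ _ aui ub av vib; have h2 := key _ _ av vib aui ub.
  rewrite distrC in h2; rewrite ger0_norm ?subr_ge0// in h1 h2.
  by rewrite ler_norml; apply/andP; split; lra.
by rewrite -mulr_suml -ltr_pdivlMr.
Qed.

Lemma geometric_path_derive_Lfun :
  (derive1 gamma \_ `[a, b]) \in Lfun (@lebesgue_measure R) 2%:E.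
Proof.
have derE t : derive1 gamma t = gamma t * c.
  by rewrite derive1E (derive_val (is_derive := is_derive_geometric_path t)).
have gc : continuous gamma.
  move=> t; apply: differentiable_continuous; apply/derivable1_diffP.
  exact: (ex_derive (is_derive := is_derive_geometric_path t)).
have derc : continuous (fun t => gamma t * c).
  by move=> t; apply: continuousM; [exact: gc | exact: cvg_cst].
rewrite (_ : derive1 gamma = fun t => gamma t * c); last exact/funext.
apply/andP; split; apply/mem_set => /=.
  apply/measurable_restrict => //; apply: measurable_funTS.
  exact: continuous_measurable_fun.
rewrite /finite_norm unlock poweR_lty//.
have sqrI : mu.-integrable `[a, b] (EFin \o (fun t => (gamma t * c) ^+ 2)).
  apply: continuous_compact_integrable; first exact: segment_compact.
  apply: continuous_subspaceT => t.
  apply: (@continuous_comp _ _ _ (fun t => gamma t * c) (fun x => x ^+ 2)).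
    exact: derc.
  exact: exprn_continuous.
apply: le_lt_trans (integrable_lty _ sqrI) => //.
rewrite [leRHS]integral_mkcond le_eqVlt; apply/orP; left; apply/eqP.
apply: eq_integral => t _; rewrite /patch /=; case: ifPn => _.
  by rewrite (powR_mulrn 2)// -normrX ger0_norm ?sqr_ge0.
by rewrite normr0 powR0.
Qed.

Lemma geometric_path_action :
  kinetic_action a b gamma = ((b - a) * (cosh c - 1))%:E.
Proof.
rewrite /kinetic_action.
under eq_integral => t _.
  rewrite derive1E (derive_val (is_derive := is_derive_log_geometric_path t)).
  over.
rewrite integral_cst// [X in (_ * X)%E](lebesgue_measure_itv `[a, b])/= lte_fin ab.
by rewrite -EFinB -EFinM mulrC.
Qed.

Lemma geometric_path_competitor : kinetic_competitor a b xa xb gamma.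
Proof.
split; [split; [split|]|exact: geometric_path_left|exact: geometric_path_right].
- exact: geometric_path_ac.
- by move=> t _; exact: geometric_path_gt0.
- exact: geometric_path_derive_Lfun.
- by rewrite geometric_path_action ltry.
Qed.

End geometric_path.

Lemma non_derivable_derive1 (R : realType) (f : R -> R) (t : R) :
  ~ derivable f t 1 -> derive1 f t = 0.
Proof. by move=> ndf; rewrite derive1E /derive (dvgP ndf). Qed.

(* True also where [h] is not differentiable: both derivatives are then the
   default value 0.  This is what makes the derivative of [ln h] measurable. *)
Lemma derive1_log_coordinate (R : realType) (a b : R) (h : R -> R) (t : R) :
  (forall x, x \in `[a, b] -> 0 < h x) -> t \in `]a, b[ ->
  derive1 (log_coordinate h) t = derive1 h t * expR (- ln (h t)).
Proof.
move=> h0; rewrite in_itv/= => /andP[at_ tb].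
have ht0 : 0 < h t by apply: h0; rewrite in_itv/= !ltW.
have [dh|ndh] := pselect (derivable h t 1).
  have := is_derive1_comp (is_derive1_ln ht0) (derivableP dh).
  by move=> H; rewrite !derive1E (derive_val (is_derive := H)) expRN lnK ?posrE// mulrC.
rewrite !non_derivable_derive1 ?mul0r// => dl; apply: ndh.
have d2 := is_derive1_comp (is_derive_expR _) (derivableP dl).
apply: (@near_eq_derivable _ _ _ (expR \o log_coordinate h)); last first.
  exact: (ex_derive (is_derive := d2)).
near=> y => /=; rewrite /log_coordinate lnK// posrE h0// in_itv/=.
apply/andP; split; apply: ltW.
  by near: y; exact: lt_nbhsr.
by near: y; exact: lt_nbhsl.
Unshelve. all: by end_near. Qed.

Lemma measurable_coshB1 (R : realType) (D : set R) (f : R -> R) :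
  measurable_fun D f -> measurable_fun D (fun t => (cosh (f t) - 1)%:E).
Proof.
have mexp := continuous_measurable_fun (@continuous_expR R).
move=> mf; apply/measurable_EFinP; apply: measurable_funB => //.
apply: measurable_funM => //; apply: measurable_funD; first exact: (measurableT_comp mexp).
by apply: (measurableT_comp mexp); exact: measurableT_comp.
Qed.

Section competitor.
Context {R : realType} (a b : R) (h : R -> R).
Hypothesis ab : a < b.
Hypothesis kah : kinetically_admissible a b h.
Local Notation mu := (@lebesgue_measure R).
Local Notation xi := (log_coordinate h).

Let h_gt0 t : t \in `[a, b] -> 0 < h t.
Proof. by case: kah => -[_ H _] _; exact: H. Qed.

Let xi_ac : ac_on a b xi.
Proof.
case: kah => -[ach _ _] _; apply: ac_on_ln => //; first exact: ltW.
exact: absolutely_continuous_ac_on.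
Qed.

Lemma measurable_derive1_log_coordinate : measurable_fun `]a, b[ (derive1 xi).
Proof.
case: kah => -[_ _ Lh] _.
apply: (eq_measurable_fun (fun t => (derive1 h \_ `[a, b]) t * expR (- clamped a b xi t))).
  move=> t /set_mem /= tab.
  rewrite (derive1_log_coordinate _ _ _ _ _ h_gt0 tab).
  move: tab; rewrite in_itv/= => /andP[/ltW at_ /ltW tb].
  by rewrite /clamped clamp_id// /patch ifT//; apply: mem_set; rewrite /= in_itv/= at_ tb.
apply: measurable_funM.
  by apply: measurable_funTS; case/andP: Lh => /set_mem.
apply: measurable_funTS; apply: continuous_measurable_fun => t.
apply: continuous_comp; last exact: continuous_expR.
by apply: continuousN; apply: clamped_continuous => //; exact: ltW.
Qed.

Lemma kinetic_density : exists phi : R -> R,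
  [/\ mu.-integrable setT (EFin \o phi),
      forall x, a <= x -> x <= b -> xi x - xi a = (\int[mu]_(t in `[a, x]) phi t) &
      kinetic_action a b h = (\int[mu]_(t in `]a, b[) (cosh (phi t) - 1)%:E)%E].
Proof.
have [phi [iphi phiE]] := ac_on_integral _ _ _ (ltW ab) xi_ac.
exists phi; split => //.
have mphi : measurable_fun setT phi by have /measurable_int/measurable_EFinP := iphi.
have mxi := measurable_coshB1 _ _ _ measurable_derive1_log_coordinate.
rewrite /kinetic_action (integral_itv_bndoo true false mxi).
apply: ae_eq_integral => //; first by apply: measurable_coshB1; exact: measurable_funTS.
have := integral_ae_derive _ _ _ _ iphi phiE.
apply: filterS; first exact: (ae_filter_ringOfSetsType mu).
by move=> t /= H /H D; rewrite derive1E (derive_val (is_derive := D)).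
Qed.

End competitor.

Section kinetic_bound.
Context {R : realType} (a b xa xb : R) (h : R -> R).
Hypothesis ab : a < b.
Hypothesis ch : kinetic_competitor a b xa xb h.
Local Notation c := ((ln xb - ln xa) / (b - a)).
Local Notation mu := (@lebesgue_measure R).

Lemma kinetic_excess : exists phi : R -> R,
  [/\ mu.-integrable setT (EFin \o phi),
      forall x, a <= x -> x <= b ->
        log_coordinate h x - ln xa = (\int[mu]_(t in `[a, x]) phi t),
      measurable_fun `]a, b[ (fun t => (cosh_excess c (phi t))%:E) &
      kinetic_action a b h = (\int[mu]_(t in `]a, b[) (cosh_excess c (phi t))%:E +
        ((b - a) * (cosh c - 1))%:E)%E].
Proof.
have [kah ha hb] := ch.
have [phi [iphi phiE actE]] := kinetic_density _ _ _ ab kah.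
have mD : @measurable _ (measurableTypeR R) `]a, b[%classic by [].
have iphiD : mu.-integrable `]a, b[ (EFin \o phi) by exact: integrableS iphi.
pose u t := cosh (phi t) - 1.
pose l t := cosh_slope c * phi t + (cosh c - 1 - cosh_slope c * c).
have iu : mu.-integrable `]a, b[ (EFin \o u).
  apply/integrableP; split.
    by apply: measurable_coshB1; have /measurable_int/measurable_EFinP := iphiD.
  have := kah.2; rewrite actE; apply: le_lt_trans.
  rewrite le_eqVlt; apply/orP; left; apply/eqP; apply: eq_integral => t _ /=.
  by rewrite ger0_norm// subr_ge0 cosh_ge1.
have il1 : mu.-integrable `]a, b[ (EFin \o (fun t => cosh_slope c * phi t)).
  exact: (integrableZl mD (cosh_slope c) iphiD).
have il2 : mu.-integrable `]a, b[ (EFin \o (cst (cosh c - 1 - cosh_slope c * c))).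
  apply: measurable_bounded_integrable => //.
    by rewrite [X in (X < _)%E](lebesgue_measure_itv `]a, b[)/= lte_fin ab -EFinB ltry.
  exists `|cosh c - 1 - cosh_slope c * c|; split; first exact: num_real.
  by move=> x Mx y _ /=; exact: ltW.
have il : mu.-integrable `]a, b[ (EFin \o l) by exact: (integrableD mD il1 il2).
have kE t : cosh_excess c (phi t) = u t - l t by rewrite /cosh_excess /u /l; ring.
have ik : mu.-integrable `]a, b[ (EFin \o (fun t => cosh_excess c (phi t))).
  have -> : (fun t => cosh_excess c (phi t)) = u \- l by exact/funext.
  exact: (integrableB mD iu il).
have lE : (\int[mu]_(t in `]a, b[) (l t)%:E)%E = ((b - a) * (cosh c - 1))%:E.
  rewrite -[LHS]fineK; last exact: integrable_fin_num il.
  rewrite -/(Rintegral mu _ _) RintegralD// RintegralZl// Rintegral_cst//.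
  rewrite [X in fine X](lebesgue_measure_itv `]a, b[)/= lte_fin ab/=.
  have -> : \int[mu]_(x in `]a, b[) phi x = ln xb - ln xa.
    have := phiE b (ltW ab) (lexx _); rewrite /log_coordinate ha hb => ->.
    by rewrite /Rintegral (integral_itv_bndoo true false (measurable_int mu iphiD)).
  by congr EFin; field; rewrite subr_eq0 gt_eqF.
exists phi; split=> //.
- by move=> x ax xb'; rewrite -phiE// /log_coordinate ha.
- exact: measurable_int ik.
- rewrite actE -lE -(integralD mD ik il); apply: eq_integral => t _.
  by rewrite -EFinD kE subrK.
Qed.

Lemma kinetic_action_ge :
  (((b - a) * (cosh c - 1))%:E <= kinetic_action a b h)%E.
Proof.
have [phi [_ _ _ ->]] := kinetic_excess.
by rewrite leeDr// integral_ge0// => t _; rewrite lee_fin cosh_excess_ge0.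
Qed.

Lemma kinetic_action_eq :
  (kinetic_action a b h <= ((b - a) * (cosh c - 1))%:E)%E ->
  forall t, t \in `[a, b] -> h t = geometric_path a b xa xb t.
Proof.
have [[[_ h_gt0 _] _] _ _] := ch.
have [phi [iphi phiE mex ->]] := kinetic_excess.
rewrite -leeBrDr// subee// => int0 t tab.
have {}int0 : (\int[mu]_(t in `]a, b[) `|(cosh_excess c (phi t))%:E|)%E = 0%E.
  apply/eqP; rewrite eq_le integral_ge0// andbT; apply: le_trans int0.
  rewrite le_eqVlt; apply/orP; left; apply/eqP; apply: eq_integral => x _.
  by rewrite abse_EFin ger0_norm// cosh_excess_ge0.
have aephi := (ae_eq_integral_abs mu (measurable_itv _) mex).1 int0.
have ht := h_gt0 _ tab.
move: (tab); rewrite in_itv/= => /andP[at_ tb].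
rewrite -[LHS](lnK (_ : h t \in Num.pos)) ?posrE// /geometric_path.
congr expR; rewrite -/(log_coordinate h t) -[LHS](subrK (ln xa)) phiE// addrC.
congr (_ + _).
have int_ : mu.-integrable `]a, t[ (EFin \o phi) by exact: integrableS iphi.
transitivity (\int[mu]_(x in `]a, t[) c).
  rewrite /Rintegral (integral_itv_bndoo true false (measurable_int mu int_)).
  congr fine; apply: ae_eq_integral => //; first exact: measurable_int int_.
  apply: (@filterS _ _ (ae_filter_ringOfSetsType mu) _ _ _ aephi).
  move=> x H; rewrite /= in_itv/= => /andP[ax xt]; congr EFin.
  have /= := H; rewrite in_itv/= ax (lt_le_trans xt tb) => /(_ isT) [].
  exact: cosh_excess_eq0.
rewrite Rintegral_cst// [X in fine X](lebesgue_measure_itv `]a, t[)/= lte_fin.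
case: ltgtP at_ => // [at_|<-] _ /=; first by ring.
by rewrite subrr; ring.
Qed.

End kinetic_bound.

Theorem corollary4p10 (R : realType) (a b xa xb : R)
    (hab : a < b) (hxa : 0 < xa) (hxb : 0 < xb) :
  [/\ kinetic_minimizer a b xa xb (geometric_path a b xa xb),
      (forall g : R -> R, kinetic_minimizer a b xa xb g ->
         forall t : R, t \in `[a, b] -> g t = geometric_path a b xa xb t),
      (forall t : R, t \in `[a, b] ->
         is_derive t 1 (log_coordinate (geometric_path a b xa xb))
           ((ln xb - ln xa) / (b - a))) &
      kinetic_action a b (geometric_path a b xa xb) =
        ((b - a) * (cosh ((ln xb - ln xa) / (b - a)) - 1))%:E].
Proof.
have compg := geometric_path_competitor _ _ _ _ hab hxa hxb.
have actE := geometric_path_action a b xa xb hab.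
split.
- split; first exact: compg.
  by move=> h /(kinetic_action_ge _ _ _ _ _ hab); rewrite actE.
- move=> g [compg' ming] t tab.
  apply: (kinetic_action_eq _ _ _ _ _ hab compg' _ t tab).
  by rewrite -actE; exact: ming.
- by move=> t _; exact: is_derive_log_geometric_path.
- exact: actE.
Qed.
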